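(* Let $\mu:\mathcal{P}(\mathcal{C})\to L^*$ be a capacity which takes values only in $L$, and let $f,g:\mathcal{C}\to L^*$ be two input vectors with $f\le_\ell g$ (i.e. $f_i\le_\ell g_i$ for all $i\in\mathcal{C}$). Then $$\int_{\mathrm{DPR},\mu}^{\to_D} f\;\le_\ell\; \int_{\mathrm{DPR},\mu}^{\to_D} g .$$
   Context: Residuated lattice: $L=(L,\wedge,\vee,\otimes,\to,0,1)$ is a linearly ordered residuated lattice: $(L,\wedge,\vee,0,1)$ is a linearly ordered lattice with bottom $0$ and top $1$ ($0\neq 1$), $(L,\otimes,1)$ is a commutative monoid, and $\alpha\otimes\beta\le\gamma$ iff $\alpha\le\beta\to\gamma$. The underlying ordered set of $L$ is either a closed real interval $[a,b]$ with $a<b$ or a finite subset of $[a,b]$ containing $a$ and $b$ (with $0,1$ denoting the bottom and top elements). Standing assumption: $L$ has no zero divisors with respect to $\otimes$, i.e. $\alpha\otimes\beta=0$ implies $\alpha=0$ or $\beta=0$. Dragonfly algebra: $L^*=L\cup\{*\}$ with $*\notin L$ (the ''unknown value''). Its linear order $\le_\ell$ extends the order of $L$ by $0<_\ell *<_\ell\alpha$ for all $\alpha\in L\setminus\{0\}$; $\wedge_D,\vee_D$ are the minimum and maximum with respect to $\le_\ell$, and $\bigwedge_D,\bigvee_D$ denote infimum and supremum with respect to $\le_\ell$ (with $\bigwedge_D\emptyset=1$, $\bigvee_D\emptyset=0$). The residuum $\to_D$ on $L^*$ is: $\alpha\to_D\beta=\alpha\to\beta$ for $\alpha,\beta\in L$;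 $\alpha\to_D *=*$ for $\alpha\in L\setminus\{0\}$; $0\to_D *=1$; $*\to_D *=1$; $*\to_D 0=*$; $*\to_D\beta=\beta$ for $\beta\in L\setminus\{0\}$. $\mathcal{C}=\{1,\dots,n\}$ is a finite non-empty set with power set $\mathcal{P}(\mathcal{C})$. An input vector is a map $f:\mathcal{C}\to L^*$, $f_i=f(i)$. A capacity is a map $\mu:\mathcal{P}(\mathcal{C})\to L^*$ with $\mu(\emptyset)=0$, $\mu(\mathcal{C})=1$, and $A\subseteq B\Rightarrow\mu(A)\le_\ell\mu(B)$. Put $\mu^c(A)=\mu(\mathcal{C}\setminus A)\to_D 0$. The residuum-based qualitative integral is $$\int_{\mathrm{DPR},\mu}^{\to_D} f=\bigwedge_{D,\,A\subseteq\mathcal{C}}\Big(\mu^c(A)\to_D\bigvee_{D,\,i\in A}f_i\Big).$$ *)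

(* Defs.v *)
From HB Require Import structures.
From mathcomp Require Import boolp classical_sets cardinality set_interval reals.
(* Imported last, so that [set0], [set: T], ~: are those of finset. *)
From mathcomp Require Import all_boot all_order all_algebra.

Set Implicit Arguments.
Unset Strict Implicit.
Unset Printing Implicit Defensive.

Import Order.TTheory.
Local Open Scope order_scope.

Record real_chain (R : realType) := RealChain {
  lo : R;
  hi : R;
  lo_lt_hi : lo < hi;
  carrier : set R;
  carrierP : carrier = `[lo, hi]%classic \/
    [/\ finite_set carrier, (carrier `<=` `[lo, hi])%classic, carrier lo & carrier hi]
}.

Definition chain_sort (R : realType) (C : real_chain R) : Type :=
  {x : R | x \in carrier C}.
Coercion chain_sort : real_chain >-> Sortclass.

Fact chain_display : Order.disp_t. Proof. exact: Order.Disp tt tt. Qed.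

Section ChainOrder.
Variables (R : realType) (C : real_chain R).

HB.instance Definition _ := SubChoice.on C.
HB.instance Definition _ :=
  [SubChoice_isSubOrder of chain_sort C by <: with chain_display].

Fact lo_carrier : lo C \in carrier C.
Proof.
apply/mem_set; case: (carrierP C) => [->|[]//].
by rewrite /= in_itv /= lexx ltW ?lo_lt_hi.
Qed.

Fact hi_carrier : hi C \in carrier C.
Proof.
apply/mem_set; case: (carrierP C) => [->|[]//].
by rewrite /= in_itv /= lexx ltW ?lo_lt_hi.
Qed.

Fact carrier_bounds (x : C) : lo C <= val x <= hi C.
Proof.
move: (val x) (set_mem (valP x)) => y Cy.
suff : `[lo C, hi C]%classic y by rewrite /= in_itv.
by case: (carrierP C) => [<-|[_ sub _ _]]; [|exact: sub].
Qed.

Fact chain_le0x (x : C) : (exist _ (lo C) lo_carrier : C) <= x.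
Proof. by rewrite leEsub; case/andP: (carrier_bounds x). Qed.

Fact chain_lex1 (x : C) : x <= (exist _ (hi C) hi_carrier : C).
Proof. by rewrite leEsub; case/andP: (carrier_bounds x). Qed.

HB.instance Definition _ :=
  Order.hasBottom.Build chain_display (chain_sort C) chain_le0x.
HB.instance Definition _ :=
  Order.hasTop.Build chain_display (chain_sort C) chain_lex1.

Lemma chain_top_neq_bot : (\top : C) != \bot.
Proof. by rewrite -val_eqE /= gt_eqF // lo_lt_hi. Qed.

End ChainOrder.

(* The lattice part, linearity and the bounds come from the [tbOrderType]. *)
Record residuated_lattice (d : Order.disp_t) (L : tbOrderType d) :=
  ResiduatedLattice {
  otimes : L -> L -> L;
  residuum : L -> L -> L;
  otimesA : associative otimes;
  otimesC : commutative otimes;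
  otimes1 : left_id \top otimes;
  adjunction : forall x y z : L, (otimes x y <= z) = (x <= residuum y z)
}.

Definition no_zero_divisors (d : Order.disp_t) (L : tbOrderType d)
    (RL : residuated_lattice L) : Prop :=
  forall x y : L, otimes RL x y = \bot -> x = \bot \/ y = \bot.

Definition dragonfly (R : realType) (C : real_chain R) : Type := option C.

Definition known (R : realType) (C : real_chain R) (x : C) : dragonfly C :=
  Some x.

Definition unknown (R : realType) (C : real_chain R) : dragonfly C := None.
Arguments unknown {R C}.

Fact dragonfly_display : Order.disp_t. Proof. exact: Order.Disp tt tt. Qed.

Section DragonflyOrder.
Variables (R : realType) (C : real_chain R).
Implicit Types x y z : dragonfly C.

HB.instance Definition _ := Choice.copy (dragonfly C) (option C).

(* [None] is the value *, inserted immediately above the bottom of [C]. *)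
Definition le_dragonfly x y : bool :=
  match x, y with
  | Some a, Some b => a <= b
  | Some a, None => a == \bot
  | None, Some b => b != \bot
  | None, None => true
  end.

Definition lt_dragonfly x y := (y != x) && le_dragonfly x y.
Definition min_dragonfly x y := if lt_dragonfly x y then x else y.
Definition max_dragonfly x y := if lt_dragonfly x y then y else x.

Fact le_dragonfly_anti : antisymmetric le_dragonfly.
Proof.
move=> [a|] [b|] //=; first by move=> /le_anti ->.
- by case: eqP.
- by case: eqP.
Qed.

Fact le_dragonfly_trans : transitive le_dragonfly.
Proof.
move=> [b|] [a|] [c|] //=; first exact: le_trans.
- by move=> ab /eqP b0; rewrite b0 lex0 in ab.
- by move=> b0 bc; apply: contraNneq b0 => c0; rewrite c0 lex0 in bc.
- by move=> /eqP -> _; rewrite le0x.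
Qed.

Fact le_dragonfly_total : total le_dragonfly.
Proof. by move=> [a|] [b|] //=; [exact: le_total | case: eqP | case: eqP]. Qed.

HB.instance Definition _ := Order.isOrder.Build dragonfly_display (dragonfly C)
  (fun _ _ => erefl) (fun _ _ => erefl) (fun _ _ => erefl)
  le_dragonfly_anti le_dragonfly_trans le_dragonfly_total.

Fact dragonfly_le0x x : known \bot <= x.
Proof. by case: x => [a|]; [exact: (le0x a) | exact: eqxx]. Qed.

Fact dragonfly_lex1 x : x <= known \top.
Proof. by case: x => [a|]; [exact: (lex1 a) | exact: chain_top_neq_bot]. Qed.

HB.instance Definition _ :=
  Order.hasBottom.Build dragonfly_display (dragonfly C) dragonfly_le0x.
HB.instance Definition _ :=
  Order.hasTop.Build dragonfly_display (dragonfly C) dragonfly_lex1.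

End DragonflyOrder.

Definition residuumD (R : realType) (C : real_chain R)
    (RL : residuated_lattice C) (x y : dragonfly C) : dragonfly C :=
  match x, y with
  | Some a, Some b => known (residuum RL a b)
  | Some a, None => if a == \bot then known \top else unknown
  | None, None => known \top
  | None, Some b => if b == \bot then unknown else known b
  end.

Record is_capacity (R : realType) (C : real_chain R) (n : nat)
    (mu : {set 'I_n} -> dragonfly C) : Prop := IsCapacity {
  capacity0 : mu set0 = \bot;
  capacityT : mu [set: 'I_n] = \top;
  capacityS : forall A B : {set 'I_n}, A \subset B -> mu A <= mu B
}.

Definition conjugate (R : realType) (C : real_chain R)
    (RL : residuated_lattice C) (n : nat) (mu : {set 'I_n} -> dragonfly C)
    (A : {set 'I_n}) : dragonfly C :=
  residuumD RL (mu (~: A)) \bot.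

(* All infima and suprema are over finite families in a bounded chain, so the
   iterated binary [\meet] (empty value [\top]) and [\join] (empty value [\bot])
   are the infimum and the supremum. *)
Definition dpr_integral (R : realType) (C : real_chain R)
    (RL : residuated_lattice C) (n : nat) (mu : {set 'I_n} -> dragonfly C)
    (f : 'I_n -> dragonfly C) : dragonfly C :=
  \meet_(A : {set 'I_n})
     residuumD RL (conjugate RL mu A) (\join_(i in A) f i).

(* Main.v *)
Require Import Defs.
From mathcomp Require Import all_boot all_order all_algebra.
From mathcomp Require Import reals.

(** The integral is an infimum of terms [mu^c(A) -> sup_(i in A) f_i]; the
    suprema increase with [f], so everything rests on the monotonicity of the
    residuum on the dragonfly algebra in its second argument.  Monotonicity
    holds when the first argument [a] is a known value.  If [a] is the bottom,
    then [a -> y] is the top for every [y].  Otherwise [a -> *] is [*] itself,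
    and the point [*] has to separate [a -> 0] from all [a -> b] with [b]
    nonzero:
    - [a -> 0] is zero because [L] has no zero divisors
      ([residuum_bot_neq_bot]);
    - [a -> b] is nonzero because it is at least [b] ([residuum_ge]).

    For an unknown first argument monotonicity can fail: if [b] lies strictly
    between the bottom and the top, then [* < b], but [* -> *] is the top and
    [* -> b] is only [b].  As [mu] takes known values only, so does its
    conjugate, and this case does not arise. *)

Import Order.TTheory.
Local Open Scope order_scope.

Set Implicit Arguments.
Unset Strict Implicit.
Unset Printing Implicit Defensive.

Section Residuum.
Variables (d : Order.disp_t) (L : tbOrderType d) (RL : residuated_lattice L).
Implicit Types x y z : L.

Lemma residuum_modus_ponens x y : otimes RL (residuum RL x y) x <= y.
Proof. by rewrite adjunction. Qed.

Lemma residuum_monor x y z : y <= z -> residuum RL x y <= residuum RL x z.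
Proof.
by move=> yz; rewrite -adjunction (le_trans (residuum_modus_ponens x y)).
Qed.

(** Weakening: the unit of the product is the top, so [y * x <= y]. *)
Lemma residuum_ge x y : y <= residuum RL x y.
Proof.
rewrite -adjunction otimesC adjunction.
apply: le_trans (lex1 x) _.
by rewrite -adjunction otimes1.
Qed.

Lemma residuum_bot y : residuum RL \bot y = \top.
Proof.
apply/eqP; rewrite -le1x -adjunction otimes1; exact: le0x.
Qed.

Lemma residuum_bot_neq_bot x :
  no_zero_divisors RL -> x != \bot -> residuum RL x \bot = \bot.
Proof.
move=> nzd /eqP x0.
have := residuum_modus_ponens x \bot; rewrite lex0 => /eqP prod0.
by case: (nzd _ _ prod0).
Qed.

End Residuum.

Section Dragonfly.
Variables (R : realType) (C : real_chain R) (RL : residuated_lattice C).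

Lemma residuumD_known_monor (a : C) (x y : dragonfly C) :
  no_zero_divisors RL -> x <= y ->
  residuumD RL (known a) x <= residuumD RL (known a) y.
Proof.
move=> nzd; have [->|a0] := eqVneq a \bot.
  suff top z : residuumD RL (known \bot) z = \top by rewrite !top.
  by case: z => [z|] /=; rewrite ?residuum_bot ?eqxx.
case: x y => [x|] [y|] //=; rewrite ?(negPf a0).
- exact: (@residuum_monor _ _ RL a x y).
- by move=> /eqP ->; rewrite residuum_bot_neq_bot //; exact: eqxx.
- move=> y0; change (residuum RL a y != \bot).
  by apply: contraNneq y0 => ay0; rewrite -lex0 -ay0 residuum_ge.
Qed.

End Dragonfly.

Theorem theorem2 (R : realType) (C : real_chain R) (RL : residuated_lattice C)
    (hL : no_zero_divisors RL) (n : nat) (hn : (0 < n)%N)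
    (mu : {set 'I_n} -> dragonfly C) (hmu : is_capacity mu)
    (hmuL : forall A : {set 'I_n}, exists x : C, mu A = known x)
    (f g : 'I_n -> dragonfly C) (hfg : forall i : 'I_n, f i <= g i) :
  dpr_integral RL mu f <= dpr_integral RL mu g.
Proof.
rewrite /dpr_integral; apply/meetsP => A _; apply: (meets_max (j := A)) => //.
rewrite /conjugate; have [x ->] := hmuL (~: A).
apply: residuumD_known_monor => //.
by apply/joinsP => i iA; apply: (joins_min (j := i)).
Qed.
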